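(* Let $n\ge 1$ be an integer and let $A$ be any commutative ring. Then the algebra $M_n(A)$ of $n\times n$ matrices over $A$ satisfies the standard polynomial $S_{2n}$, i.e. for all $a_1,\ldots,a_{2n}\in M_n(A)$ one has $$S_{2n}(a_1,\ldots,a_{2n})=\sum_{\sigma\in \mathfrak S_{2n}}\epsilon_\sigma\, a_{\sigma(1)}a_{\sigma(2)}\cdots a_{\sigma(2n)}=0.$$
   Context: For an integer $h\ge 1$, $\mathfrak S_h$ is the symmetric group of permutations of $\{1,\ldots,h\}$ and $\epsilon_\sigma$ denotes the sign of $\sigma\in\mathfrak S_h$. The standard polynomial $S_h$ is the element of the free associative algebra in the variables $x_1,\ldots,x_h$ given by $S_h(x_1,\ldots,x_h)=\sum_{\sigma\in\mathfrak S_h}\epsilon_\sigma x_{\sigma(1)}\cdots x_{\sigma(h)}$. An algebra satisfies a polynomial if that polynomial vanishes under every substitution of elements of the algebra for the variables. *)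

(* Defs.v *)
From HB Require Import structures.
From mathcomp Require Import all_boot all_order all_algebra all_fingroup.

Set Implicit Arguments.
Unset Strict Implicit.
Unset Printing Implicit Defensive.

Import GRing.Theory.
Local Open Scope ring_scope.

(* Value of the standard polynomial S_h at x_1, ..., x_h, in an arbitrary,
   possibly noncommutative ring. The variables are indexed by 'I_h, that is
   from 0 to h - 1; \prod_(i < h) multiplies its factors from left to right in
   increasing order of i, and the coercion of s : 'S_h to bool is its parity. *)
Definition standard_poly (R : pzRingType) (h : nat) (x : 'I_h -> R) : R :=
  \sum_(s : 'S_h) (-1) ^+ s * \prod_(i < h) x (s i).

(* Main.v *)
Require Import Defs.
From HB Require Import structures.
From mathcomp Require Import all_boot all_order all_algebra all_fingroup.

Set Implicit Arguments.
Unset Strict Implicit.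
Unset Printing Implicit Defensive.

Import GRing.Theory.
Local Open Scope ring_scope.

(** This is the Amitsur-Levitzki theorem, proved by Rosset's argument.

    Let first the scalars be a field F of characteristic 0. Take h = 2n
    anticommuting elements e_i of square zero with nonzero product, and put
    X = sum_i a_i e_i, an n x n matrix over the Grassmann algebra of the e_i.
    In X^h only the terms indexed by permutations survive, and reordering the
    e_i produces signs, so that X^h = S_h(a) e_0 ... e_(h-1)
    [expr_sum_anticomm]; it suffices to show that (X^2)^n = 0. The entries of
    X^2 are even, hence lie in a commutative ring. There the trace of (X^2)^k
    is that of X Z X with Z = (X^2)^(k-1) even, and moving one odd factor X
    around the trace changes its sign; so tr((X^2)^k) = 0 for all k > 0. Over a
    commutative ring without integer torsion, a matrix all of whose powers are
    traceless is nilpotent of order its size, by Newton's identities and the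
    Cayley-Hamilton theorem [exprm_eq0_trace].

    The result over the rationals gives it over the integers. As S_h is
    multilinear, its vanishing on all matrices over A follows from its vanishing
    on matrix units, which are images of integer matrices. *)

(** * Traces of powers and nilpotency *)

Lemma deriv_prod (C : comNzRingType) (I : eqType) (r : seq I)
    (F : I -> {poly C}) :
  uniq r ->
  (\prod_(i <- r) F i)^`() =
  \sum_(i <- r) (F i)^`() * \prod_(j <- r | j != i) F j.
Proof.
elim: r => [|i r IHr] /=; first by rewrite !big_nil derivC.
case/andP=> ir /IHr{}IHr.
rewrite !big_cons derivM eqxx /= IHr mulr_sumr; congr (_ * _ + _).
  rewrite big_seq [RHS]big_seq_cond; apply: eq_bigl => j.
  by case: (boolP (j \in r)) => //= jr; apply/esym; apply: contraNneq ir => <-.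
rewrite [LHS]big_seq [RHS]big_seq; apply: eq_bigr => j jr.
rewrite big_cons mulrCA (_ : i != j) //.
by apply: contraNneq ir => ->.
Qed.

(** Jacobi's formula: by the Leibniz expansion, the derivative of the determinant
    of 'X - B is the sum of its principal minors of codimension one. *)
Lemma deriv_char_poly (C : comNzRingType) (n : nat) (B : 'M[C]_n) :
  (char_poly B)^`() = \tr (\adj (char_poly_mx B)).
Proof.
set M := char_poly_mx B.
have dM i j : (M i j)^`() = (i == j)%:R.
  by rewrite !mxE derivB derivC subr0 derivMn derivX.
rewrite /char_poly -/M /determinant raddf_sum /mxtrace.
under eq_bigr => s _.
  rewrite raddfMsign /= deriv_prod ?index_enum_uniq //.
  rewrite mulr_sumr.
  over.
rewrite exchange_big; apply: eq_bigr => i _ /=.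
rewrite mxE expand_cofactor [RHS]big_mkcond; apply: eq_bigr => s _ /=.
rewrite dM eq_sym; case: eqP => _; last by rewrite mul0r mulr0.
rewrite mul1r; congr (_ * _).
by apply: eq_bigl => j; rewrite eq_sym.
Qed.

(** Newton's identities in coefficient form. Let Q_j be the coefficient of 'X^j
    in the adjugate of 'X - B, and p the characteristic polynomial. Then
    Q_j = p_(j+1) + Q_(j+1) B, so tr(Q_j B^(k+1)) = 0 for all j, k by descent
    on j, and tr Q_j = d p_(j+1), where d is the order of B. Jacobi's formula
    gives tr Q_j = (j+1) p_(j+1), and the relation p_0 + Q_0 B = 0 gives
    d p_0 = 0; hence p = 'X^d in the absence of torsion. *)
Lemma exprm_eq0_trace (C : comNzRingType) (n : nat) (B : 'M[C]_n.+1) :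
    (forall k (c : C), c *+ k.+1 = 0 -> c = 0) ->
    (forall k, \tr (B ^+ k.+1) = 0) ->
  B ^+ n.+1 = 0.
Proof.
move=> tfC trB.
set p : {poly C} := char_poly B; set M := char_poly_mx B.
pose Q j : 'M[C]_n.+1 := \matrix_(a, b) (\adj M a b)`_j.
have adjE a b : \sum_c \adj M a c * M c b = p *+ (a == b).
  by have /matrixP/(_ a b) := mul_adj_mx M; rewrite [LHS]mxE [RHS]mxE.
have QB j a b : (\sum_c \adj M a c * (B c b)%:P)`_j = (Q j *m B) a b.
  by rewrite coef_sum [RHS]mxE; apply: eq_bigr => c _; rewrite coefMC [Q j a c]mxE.
have adjE' a b : \adj M a b * 'X - \sum_c \adj M a c * (B c b)%:P = p *+ (a == b).
  have ME c : M c b = 'X *+ (c == b) - (B c b)%:P by rewrite !mxE.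
  rewrite -adjE; under [RHS]eq_bigr => c _ do rewrite ME mulrBr.
  rewrite sumrB; congr (_ - _).
  rewrite (bigD1 b) //= eqxx big1 ?addr0 // => c cb.
  by rewrite (negPf cb) mulr0.
have QS j : Q j = (p`_j.+1)%:M + Q j.+1 *m B.
  apply/matrixP=> a b; have /(congr1 (fun q : {poly C} => q`_j.+1)) := adjE' a b.
  rewrite coefB coefMX QB coefMn /= => /eqP.
  rewrite subr_eq => /eqP eqQ.
  by rewrite [RHS]mxE [_%:M a b]mxE [LHS]mxE.
have Q0 : (p`_0)%:M = - (Q 0%N *m B).
  apply/matrixP=> a b; have /(congr1 (fun q : {poly C} => q`_0)) := adjE' a b.
  rewrite coefB coefMX QB coefMn /= sub0r => eqp0.
  by rewrite [RHS]mxE [LHS]mxE eqp0.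
have trQB m : forall j k, (forall i, (j + m <= i)%N -> Q i = 0) ->
    \tr (Q j *m B ^+ k.+1) = 0.
  elim: m => [|m IHm] j k Qbig.
    by rewrite Qbig ?addn0 // mul0mx mxtrace0.
  rewrite QS mulmxDl mxtraceD mul_scalar_mx mxtraceZ trB mulr0 add0r.
  rewrite -mulmxA -[B *m _]/(B * _) -exprS IHm // => i.
  by rewrite addSnnS => /Qbig.
(* Q_j vanishes for j >= m, which starts the descent. *)
pose m := \max_(ab : 'I_n.+1 * 'I_n.+1) size (\adj M ab.1 ab.2).
have {}trQB j : \tr (Q j *m B) = 0.
  rewrite -[B]expr1; apply: (trQB m) => i lei.
  apply/matrixP=> a b; rewrite [LHS]mxE [RHS]mxE nth_default //.
  apply: leq_trans (leq_trans (leq_addl j m) lei).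
  exact: (leq_bigmax (F := fun ab => size (\adj M ab.1 ab.2)) (a, b)).
have pS j : p`_j.+1 *+ n.+1 = p`_j.+1 *+ j.+1.
  rewrite -coef_deriv deriv_char_poly -/M -mxtrace_scalar.
  have /(congr1 mxtrace) := QS j; rewrite mxtraceD trQB addr0 => <-.
  by rewrite [RHS]coef_sum; apply: eq_bigr => i _; rewrite mxE.
have pS0 j : (j < n)%N -> p`_j.+1 = 0.
  move=> ltjn; apply: (tfC (n - j).-1); rewrite prednK ?subn_gt0 //.
  by rewrite -subSS mulrnBr ?ltnS 1?ltnW // pS subrr.
have p0 : p`_0 = 0.
  apply: (tfC n); rewrite -mxtrace_scalar Q0.
  by rewrite raddfN /= trQB oppr0.
have -> : B ^+ n.+1 = horner_mx B p.
  suff -> : p = 'X^(n.+1) by rewrite rmorphXn /= horner_mx_X.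
  apply/polyP=> i; rewrite coefXn.
  case: (ltngtP i n.+1) => [lti|gti|->].
  - by case: i lti => [|j] // /pS0.
  - by rewrite nth_default // size_char_poly.
  - have := char_poly_monic B; rewrite monicE lead_coefE size_char_poly /=.
    by move/eqP.
exact: Cayley_Hamilton.
Qed.

(** * Anticommuting elements *)

Lemma prod_anticomm_lift (R : pzRingType) (m : nat) (x : 'I_m.+1 -> R) :
    (forall a b, x a * x b = - (x b * x a)) ->
  forall j : 'I_m.+1, \prod_i x i = (-1) ^+ j * (x j * \prod_i x (lift j i)).
Proof.
elim: m x => [|m IHm] x xC j.
  by rewrite ord1 mul1r big_ord_recl.
rewrite big_ord_recl; case: (unliftP ord0 j) => [j'|] ->; last by rewrite mul1r.
rewrite (IHm (fun i => x (lift ord0 i)) _ j'); last by move=> a b; apply: xC.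
rewrite mulrA (commr_sign _ j') -mulrA lift0 exprS mulN1r mulNr -mulrN.
congr (_ * _); rewrite mulrA xC mulNr -mulrA big_ord_recl.
have -> : lift (lift ord0 j') ord0 = ord0 :> 'I_m.+2 by apply: val_inj.
congr (- (_ * (_ * _))); apply: eq_bigr => i _; congr x; apply: val_inj => /=.
by rewrite /bump !leq0n !add1n !ltnS addnS.
Qed.

(** Induction on m: the factor x (s ord0) comes first on the left-hand side, and
    is brought to the front on the right-hand side by [prod_anticomm_lift]. *)
Lemma prod_anticomm_perm (R : pzRingType) (m : nat) (x : 'I_m -> R) :
    (forall a b, x a * x b = - (x b * x a)) ->
  forall s : 'S_m, \prod_i x (s i) = (-1) ^+ s * \prod_i x i.
Proof.
elim: m x => [|m IHm] x xC s.
  by rewrite !big_ord0 (_ : s = 1%g) ?odd_perm1 ?mul1r //; apply/permP=> -[].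
rewrite big_ord_recl; pose j := s ord0.
have ltP (i : 'I_m) : {k : 'I_m | s (lift ord0 i) = lift j k}.
  have: j != s (lift ord0 i) by rewrite (inj_eq perm_inj) neq_lift.
  by case/unlift_some=> k -> _; exists k.
pose t (i : 'I_m) : 'I_m := sval (ltP i).
have tE i : s (lift ord0 i) = lift j (t i).
  exact: (svalP (ltP i)).
have t_inj : injective t.
  move=> i k eqt; apply: (@lift_inj _ ord0); apply: (@perm_inj _ s).
  by rewrite !tE eqt.
have -> : s = lift_perm ord0 j (perm t_inj).
  apply/permP=> i; case: (unliftP ord0 i) => [k|] ->; rewrite ?lift_perm_id //.
  by rewrite lift_perm_lift permE tE.
rewrite odd_lift_perm lift_perm_id (prod_anticomm_lift xC j).
under [X in x j * X]eq_bigr => i _ do rewrite lift_perm_lift.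
rewrite (IHm (fun i => x (lift j i))) => [|a b]; last exact: xC.
rewrite -(signr_odd R j) [RHS]mulrA -signr_addb /= (addbC (odd j)) addbK.
by rewrite mulrA commr_sign -mulrA.
Qed.

(** Both x a and x b can be brought to the front of the product. *)
Lemma prod_anticomm_eq0 (R : pzRingType) (m : nat) (x : 'I_m -> R) (a b : 'I_m) :
    (forall a b, x a * x b = - (x b * x a)) ->
  a != b -> x a * x b = 0 -> \prod_i x i = 0.
Proof.
case: m x a b => [|m] x a b xC; first by case: a.
case/unlift_some=> b' -> _ {b} xab0; rewrite (prod_anticomm_lift xC a).
case: m x xC a b' xab0 => [|m] x xC a b' xab0; first by case: b' xab0.
rewrite (@prod_anticomm_lift _ _ (fun i => x (lift a i)) _ b') => [|c d].
  by rewrite (mulrA (x a)) commr_sign -mulrA (mulrA (x a)) xab0 mul0r !mulr0.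
exact: xC.
Qed.

(** Generators of a Grassmann algebra, represented by square matrices of order
    2 ^ m: a generator is added by doubling the order, the former e_i becoming
    diag(- e_i, e_i) and the new one having the identity as its only nonzero
    block, in the upper right corner. *)
Lemma grassmann_generators (F : fieldType) (m : nat) :
  exists N (e : 'I_m -> 'M[F]_N.+1),
    [/\ forall i j, e i * e j = - (e j * e i),
        forall i, e i * e i = 0 & \prod_i e i != 0].
Proof.
elim: m => [|m [N [e [eC e2 e0]]]].
  by exists 0%N, (fun _ => 0); split; [case|case|rewrite big_ord0 oner_neq0].
pose new : 'M[F]_(N.+1 + N.+1) := block_mx 0 1%:M 0 0.
pose old i : 'M[F]_(N.+1 + N.+1) := block_mx (- e i) 0 0 (e i).
have mulE (n : nat) (A B : 'M[F]_n.+1) : A * B = A *m B by [].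
have blockM (B1 C1 B2 C2 : 'M[F]_N.+1) :
    block_mx B1 0 0 C1 *m block_mx B2 0 0 C2
      = block_mx (B1 * B2) 0 0 (C1 * C2) :> 'M_(N.+1 + N.+1).
  by rewrite mulmx_block !(mulmx0, mul0mx, addr0, add0r).
have newM (B1 C1 : 'M[F]_N.+1) : new *m block_mx B1 0 0 C1 = block_mx 0 C1 0 0.
  by rewrite mulmx_block !(mulmx0, mul0mx, addr0, add0r) mul1mx.
have oldM i j : old i *m old j = block_mx (e i *m e j) 0 0 (e i *m e j).
  by rewrite blockM mulrNN.
have new_old i : new *m old i = block_mx 0 (e i) 0 0.
  exact: newM.
have old_new i : old i *m new = - block_mx 0 (e i) 0 0.
  rewrite mulmx_block !(mulmx0, mul0mx, addr0, add0r) mulmx1.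
  by rewrite opp_block_mx !oppr0.
have new2 : new *m new = 0.
  by rewrite mulmx_block !(mulmx0, mul0mx, addr0, add0r) block_mx0.
have oldC i j : old i *m old j = - (old j *m old i).
  by rewrite !oldM -!mulE eC opp_block_mx oppr0.
have newC i : new *m old i = - (old i *m new) by rewrite old_new opprK.
have oldC_new i : old i *m new = - (new *m old i) by rewrite newC opprK.
have new2C : new *m new = - (new *m new) by rewrite new2 oppr0.
have old2 i : old i *m old i = 0 by rewrite oldM -mulE e2 block_mx0.
exists (N + N.+1)%N, (fun i => if unlift ord0 i is Some k then old k else new).
split=> [i j|i|].
- case: (unliftP ord0 i) => [i'|] _; case: (unliftP ord0 j) => [j'|] _.
  + exact: oldC.
  + exact: oldC_new.
  + exact: newC.
  + exact: new2C.
- by case: (unliftP ord0 i) => [i'|] _; [apply: old2|apply: new2].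
rewrite big_ord_recl unlift_none.
under eq_bigr => i _ do rewrite liftK.
have -> : \prod_i old i = block_mx (\prod_i - e i) 0 0 (\prod_i e i).
  apply: (big_ind3 (fun A B C => A = block_mx B 0 0 C)) => //.
    exact: scalar_mx_block.
  by move=> A1 B1 C1 A2 B2 C2 -> ->; apply: blockM.
apply: contra_neq e0 => eqP0.
have {eqP0}eqP0 := etrans (esym (newM _ _)) eqP0.
rewrite -[LHS](@block_mxKur _ N.+1 N.+1 N.+1 N.+1 0 _ 0 0) eqP0.
by apply/matrixP=> i k; rewrite !mxE.
Qed.

(** * The commutative ring of even elements *)

Section Bicommutant.

Variables (F : fieldType) (m N : nat) (e : 'I_m -> 'M[F]_N.+1).

(* The rows of V span the same matrices as the family e. *)
Let V : 'A[F]_(m, N.+1) := \matrix_i mxvec (e i).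

(** The matrices that commute with every e_i and with everything that commutes
    with every e_i, that is, the center of the centralizer of e. When the e_i
    anticommute, it contains the even part of the algebra that they generate,
    and it is plainly a commutative ring. *)
Definition bicommutant : pred 'M[F]_N.+1 := fun x => (x \in 'Z('C(V)))%MS.

Lemma commutantP (x : 'M[F]_N.+1) :
  reflect (forall i, e i * x = x * e i) (x \in 'C(V))%MS.
Proof.
by apply: (iffP cent_rowP) => xC i; have:= xC i; rewrite rowK mxvecK.
Qed.

Lemma bicommutantP (x : 'M[F]_N.+1) :
  reflect ((forall i, e i * x = x * e i) /\
           (forall z, (forall i, e i * z = z * e i) -> z * x = x * z))
          (bicommutant x).
Proof.
apply: (iffP center_mxP) => -[xV xC]; split.
- exact/commutantP.
- by move=> z zC; apply: xC; apply/commutantP.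
- exact/commutantP.
- by move=> z /commutantP zC; apply: xC.
Qed.

Lemma bicommutant_subring : subring_closed bicommutant.
Proof.
split.
- by apply/bicommutantP; split=> *; rewrite mulr1 mul1r.
- move=> x y /bicommutantP[xV xC] /bicommutantP[yV yC]; apply/bicommutantP.
  split=> [i|z zC]; first by rewrite mulrBr mulrBl xV yV.
  by rewrite mulrBr mulrBl xC // yC.
- move=> x y /bicommutantP[xV xC] /bicommutantP[yV yC]; apply/bicommutantP.
  split=> [i|z zC]; first by rewrite mulrA xV -mulrA yV mulrA.
  by rewrite mulrA xC // -mulrA yC // mulrA.
Qed.

(** The ring of elements of the bicommutant, as a subtype of the matrix ring. *)
Definition bicomm_type := {x : 'M[F]_N.+1 | bicommutant x}.

HB.instance Definition _ := [isSub for (@sval _ _ : bicomm_type -> _)].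
HB.instance Definition _ := [Choice of bicomm_type by <:].
HB.instance Definition _ :=
  GRing.SubChoice_isSubNzRing.Build _ _ bicomm_type bicommutant_subring.

Lemma bicomm_mulC : @commutative bicomm_type _ *%R.
Proof.
move=> x y; apply: val_inj; rewrite !rmorphM.
have /bicommutantP[xV _] := valP x; have /bicommutantP[_ yC] := valP y.
exact: yC.
Qed.

HB.instance Definition _ :=
  GRing.PzRing_hasCommutativeMul.Build bicomm_type bicomm_mulC.

End Bicommutant.

(** * The power of a generic odd matrix *)

(** Matrices with entries in 'M[F]_N.+1: a i is embedded entrywise through the
    scalar matrices of order N.+1, and (e i)%:M is the scalar matrix of order
    n.+1 with e i on the diagonal. *)
Lemma expr_sum_anticomm (F : fieldType) (N n h : nat)
    (e : 'I_h -> 'M[F]_N.+1) (a : 'I_h -> 'M[F]_n.+1) :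
    (forall i j, e i * e j = - (e j * e i)) -> (forall i, e i * e i = 0) ->
  (\sum_i map_mx scalar_mx (a i) * (e i)%:M) ^+ h =
  map_mx scalar_mx (standard_poly a) * (\prod_i e i)%:M.
Proof.
move=> eC e2.
pose io : {rmorphism 'M[F]_n.+1 -> 'M['M[F]_N.+1]_n.+1} := map_mx scalar_mx.
have ioC A (r : 'M[F]_N.+1) : r%:M * io A = io A * r%:M.
  rewrite -[LHS]/(_ *m _) -[RHS]/(_ *m _) mul_scalar_mx.
  apply/matrixP=> i j; rewrite !mxE (bigD1 j) //= big1 => [|k kj].
    by rewrite !mxE eqxx addr0 mulr1n; exact: scalar_mxC.
  by rewrite !mxE (negPf kj) mulr0.
have prodE (f : 'I_h -> 'I_h) :
    \prod_i (io (a (f i)) * (e (f i))%:M) =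
    io (\prod_i a (f i)) * (\prod_i e (f i))%:M.
  apply: (big_ind3 (fun A B C => A = io B * C%:M)) => //.
    by rewrite rmorph1 mul1r.
  move=> A1 B1 C1 A2 B2 C2 -> ->.
  rewrite rmorphM -!mulrA (mulrA C1%:M) ioC -mulrA.
  by congr (_ * (_ * _)); rewrite -[LHS]/(_ *m _) -scalar_mxM.
set X := \sum_i _; have -> : X ^+ h = \prod_(i < h) X.
  by rewrite prodr_const card_ord.
rewrite {}/X bigA_distr_bigA /=.
under eq_bigr => f _ do rewrite prodE.
rewrite (bigID (fun f : {ffun 'I_h -> 'I_h} => injectiveb f)) /=.
rewrite addrC big1 ?add0r => [|f].
  rewrite (reindex (@pval _)) /=; last first.
    pose in_Sn := insubd (1%g : 'S_h).
    by exists in_Sn => /= f Uf; first apply: val_inj; apply: insubdK.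
  rewrite rmorph_sum mulr_suml.
  apply: eq_big => /= [s | s _]; first by rewrite (valP s).
  rewrite !pvalE (prod_anticomm_perm eC); case: (odd_perm s).
    by rewrite expr1 !mulN1r !raddfN /= mulNr mulrN.
  by rewrite !mul1r.
case/injectivePn=> i [j neq_ij eq_f].
rewrite (prod_anticomm_eq0 (x := fun k => e (f k)) _ neq_ij) ?eq_f //.
by rewrite raddf0 mulr0.
Qed.

(** * The theorem in characteristic zero *)

Lemma standard_poly_numField (F : numFieldType) (n : nat)
    (a : 'I_(2 * n.+1) -> 'M[F]_n.+1) :
  standard_poly a = 0.
Proof.
have [N [e [eC e2 e0]]] := grassmann_generators F (2 * n.+1).
have := expr_sum_anticomm a eC e2.
set X := \sum_i _ => XE.
(* The entries of X are odd: they are linear combinations of the e i. *)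
have XijE p q : X p q = \sum_i a i p q *: e i.
  rewrite /X summxE; apply: eq_bigr => i _.
  rewrite mxE (bigD1 q) //= big1 => [|k kq]; last by rewrite !mxE (negPf kq) mulr0.
  by rewrite !mxE eqxx addr0 mulr1n -mul_scalar_mx.
have eX i p q : e i * X p q = - (X p q * e i).
  rewrite XijE mulr_sumr mulr_suml -sumrN; apply: eq_bigr => j _.
  by rewrite -scalerAl -scalerAr eC scalerN.
have XX p q r s : X p q * X r s = - (X r s * X p q).
  rewrite (XijE p q) mulr_sumr mulr_suml -sumrN; apply: eq_bigr => j _.
  by rewrite -scalerAl -scalerAr eX scalerN.
have commX z p q : (forall i, e i * z = z * e i) -> z * X p q = X p q * z.
  move=> zC; rewrite XijE mulr_sumr mulr_suml; apply: eq_bigr => j _.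
  by rewrite -scalerAl -scalerAr zC.
(* The entries of X * X are even, so X * X comes from a matrix B over the
   commutative ring C. *)
have X2_even p q : bicommutant e ((X * X) p q).
  rewrite mxE; apply/bicommutantP; split=> [i|z zC].
    rewrite mulr_sumr mulr_suml; apply: eq_bigr => k _.
    by rewrite mulrA eX mulNr -!mulrA eX mulrN opprK.
  rewrite mulr_sumr mulr_suml; apply: eq_bigr => k _.
  by rewrite mulrA (commX z) // -!mulrA (commX z).
pose C := bicomm_type e.
pose B : 'M[C]_n.+1 := \matrix_(p, q) (Sub _ (X2_even p q) : C).
pose v : {rmorphism C -> 'M[F]_N.+1} := val.
have BE k : map_mx v (B ^+ k) = (X * X) ^+ k.
  rewrite rmorphXn; congr (_ ^+ _).
  by apply/matrixP=> p q; rewrite [LHS]mxE [B p q]mxE; apply: SubK.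
have tf k (M : 'M[F]_N.+1) : M *+ k.+1 = 0 -> M = 0.
  move/matrixP=> M0; apply/matrixP=> p q; have /eqP := M0 p q.
  by rewrite mulmxnE !mxE Num.Theory.mulrn_eq0 => /eqP.
have B0 : B ^+ n.+1 = 0.
  apply: exprm_eq0_trace => [k c c0|k].
    apply: val_inj; apply: (tf k); rewrite -[LHS](raddfMn v) c0.
    exact: raddf0.
  apply: val_inj; rewrite -[LHS]/(v _) -trace_map_mx BE [RHS]raddf0.
  (* It is enough that the trace is its own opposite. *)
  apply: (tf 1%N); rewrite mulr2n; apply/eqP; rewrite addr_eq0; apply/eqP.
  set Z := (X * X) ^+ k.
  have Ze i p q : e i * Z p q = Z p q * e i.
    rewrite /Z -BE mxE.
    by have /bicommutantP[] := valP ((B ^+ k) p q).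
  have ZX : Z * X = X * Z by apply/esym/commrX; rewrite /GRing.comm mulrA.
  have -> : (X * X) ^+ k.+1 = X * (Z * X) by rewrite exprS -mulrA ZX.
  have {2}-> : X * (Z * X) = Z * X * X by rewrite mulrA -ZX.
  (* The traces of X * (Z * X) and (Z * X) * X are opposite, the entries of X and
     of Z * X being odd. *)
  rewrite /mxtrace.
  under eq_bigr => p _ do rewrite mxE.
  under [in RHS]eq_bigr => p _ do rewrite mxE.
  rewrite exchange_big -sumrN; apply: eq_bigr => q _.
  rewrite -sumrN; apply: eq_bigr => p _.
  rewrite [(Z * X) q p]mxE mulr_sumr mulr_suml -sumrN; apply: eq_bigr => r _.
  by rewrite mulrA -commX // -!mulrA XX mulrN.
have : X ^+ (2 * n.+1) = 0.
  by rewrite exprM expr2 -BE B0 raddf0.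
rewrite XE; move: (standard_poly a) (\prod_i e i) e0 => S P P0 /matrixP SP0.
apply/matrixP=> p q; move/(_ p q): SP0.
rewrite mxE (bigD1 q) //= big1 => [|k kq]; last by rewrite !mxE (negPf kq) mulr0.
rewrite !mxE eqxx addr0 mulr1n -[LHS]/(_ *m _) mul_scalar_mx => /eqP.
by rewrite scaler_eq0 (negPf P0) orbF => /eqP.
Qed.

Lemma standard_poly_int (n : nat) (a : 'I_(2 * n.+1) -> 'M[int]_n.+1) :
  standard_poly a = 0.
Proof.
pose io : {rmorphism 'M[int]_n.+1 -> 'M[rat]_n.+1} := map_mx intr.
have := standard_poly_numField (fun i => io (a i)).
have -> : standard_poly (fun i => io (a i)) = io (standard_poly a).
  rewrite rmorph_sum; apply: eq_bigr => s _.
  by rewrite rmorphMsign rmorph_prod.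
move/matrixP=> S0; apply/matrixP=> p q; move/(_ p q): S0.
by rewrite !mxE => /eqP; rewrite intr_eq0 => /eqP.
Qed.

(** * Arbitrary commutative rings *)

Theorem mainTheorem1 (n : nat) (hn : (1 <= n)%N) (A : comPzRingType)
  (a : 'I_(2 * n) -> 'M[A]_n) :
  standard_poly a = 0.
Proof.
case: n hn a => // n _ a.
pose E (R : pzRingType) (pq : 'I_n.+1 * 'I_n.+1) : 'M[R]_n.+1 := delta_mx pq.1 pq.2.
pose c i pq := a i pq.1 pq.2.
have aE i : a i = \sum_pq c i pq *: E A pq.
  by rewrite [LHS]matrix_sum_delta pair_bigA.
(* Matrix units are images of integer matrices. *)
have unit0 (f : 'I_(2 * n.+1) -> 'I_n.+1 * 'I_n.+1) : standard_poly (E A \o f) = 0.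
  pose io : {rmorphism 'M[int]_n.+1 -> 'M[A]_n.+1} := map_mx intr.
  have ioE pq : io (E int pq) = E A pq by apply: map_delta_mx.
  transitivity (io (standard_poly (E int \o f))).
    rewrite rmorph_sum; apply: eq_bigr => s _.
    rewrite rmorphMsign rmorph_prod; congr (_ * _).
    by apply: eq_bigr => i _; rewrite /= ioE.
  by rewrite standard_poly_int rmorph0.
have prodZ (I : finType) (k : I -> A) (M : I -> 'M[A]_n.+1) :
    \prod_i (k i *: M i) = (\prod_i k i) *: \prod_i M i.
  apply: (big_ind3 (fun x y z => x = y *: z)) => //; first by rewrite scale1r.
  move=> x1 y1 z1 x2 y2 z2 -> ->.
  by rewrite -[LHS]/(_ *m _) -scalemxAl -scalemxAr scalerA.
(* Expansion of every a i in matrix units. *)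
transitivity (\sum_(f : {ffun 'I_(2 * n.+1) -> 'I_n.+1 * 'I_n.+1})
    (\prod_i c i (f i)) *: standard_poly (E A \o f)); last first.
  by apply: big1 => f _; rewrite unit0 scaler0.
under [RHS]eq_bigr => f _ do rewrite /standard_poly scaler_sumr.
rewrite exchange_big; apply: eq_bigr => s _ /=.
under eq_bigr => i _ do rewrite aE.
rewrite bigA_distr_bigA /= mulr_sumr.
(* The choice function attached to the factors in the order s is transported to
   one attached to the indices of the variables. *)
pose h (g : {ffun 'I_(2 * n.+1) -> 'I_n.+1 * 'I_n.+1}) := [ffun i => g (s i)].
rewrite (reindex h) /=; last first.
  exists (fun g => [ffun i => g ((s^-1)%g i)]) => g _; apply/ffunP=> i.
    by rewrite !ffunE permKV.
  by rewrite !ffunE permK.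
apply: eq_bigr => f _; rewrite prodZ.
under eq_bigr => i _ do rewrite ffunE.
under [X in _ *: X]eq_bigr => i _ do rewrite ffunE.
have -> : \prod_i c i (f i) = \prod_i c (s i) (f (s i)) 
  by rewrite (reindex_perm s).
by rewrite -[LHS]/(_ *m _) -scalemxAr.
Qed.
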